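(* Let $K\subset\mathbb{R}^2$ be a compact convex set with boundary of class $C^2$ and of perimeter $L$, and suppose that for some $\alpha\in(0,\pi)$ the isotopic set $C_\alpha$ of $K$ is a circle of radius $R$. Then $$L\leq L_{R}\,\sin\left(\frac{\alpha}{2}\right),\qquad\text{where } L_{R}=2\pi R.$$
   Context: The visual angle $w(P)$ of $K$ from a point $P\notin K$ is the angle in $(0,\pi)$ under which $K$ is seen from $P$, i.e. the angle at $P$ of the smallest angular sector with vertex $P$ containing $K$ (the angle between the two support lines of $K$ through $P$). The isotopic set is $C_\alpha=\{P\in\mathbb{R}^2\setminus K: w(P)=\alpha\}$. *)

(* Defs.v *)
From HB Require Import structures.
From mathcomp Require Import all_boot all_order all_algebra.
From mathcomp Require Import all_classical all_reals all_analysis.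
Set Implicit Arguments.
Unset Strict Implicit.
Unset Printing Implicit Defensive.
Import Order.TTheory GRing.Theory Num.Theory.
Import numFieldNormedType.Exports.
Local Open Scope classical_set_scope.
Local Open Scope ring_scope.

(* The library norm on a product is the sup norm: it induces the usual topology,
   but Euclidean distances have to be spelled out. *)
Notation plane R := (R^o * R^o)%type.

Definition edist (R : realType) (P Q : plane R) : R :=
  Num.sqrt ((P.1 - Q.1) ^+ 2 + (P.2 - Q.2) ^+ 2).

Definition circle (R : realType) (c : plane R) (r : R) : set (plane R) :=
  [set P | edist P c = r].

Definition frontier (T : topologicalType) (A : set T) : set T :=
  closure A `\` interior A.

Definition C2 (R : realType) (f : R -> R) : Prop :=
  [/\ forall t, derivable f t 1,
      forall t, derivable (derive1 f) t 1
    & continuous (derive1 (derive1 f))].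

Definition speed (R : realType) (g : R -> plane R) (t : R) : R :=
  Num.sqrt (derive1 (fst \o g) t ^+ 2 + derive1 (snd \o g) t ^+ 2).

Definition arc_length (R : realType) (g : R -> plane R) (a b : R) : R :=
  \int[lebesgue_measure]_(t in `[a, b]) speed g t.

(* [g] parametrizes [A], once per period [T], as a regular simple closed curve
   of class C^2. *)
Definition C2_closed_curve (R : realType) (A : set (plane R))
    (g : R -> plane R) (T : R) : Prop :=
  [/\ [/\ 0 < T, C2 (fst \o g) & C2 (snd \o g)],
      forall t, g (t + T) = g t,
      forall t, 0 < speed g t,
      {in `[0, T[ &, injective g}
    & range g = A].

Definition C2_frontier (R : realType) (K : set (plane R)) : Prop :=
  exists g T, C2_closed_curve (frontier K) g T.

(* Length of the frontier; it does not depend on the parametrization. *)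
Definition has_perimeter (R : realType) (K : set (plane R)) (L : R) : Prop :=
  exists g T, C2_closed_curve (frontier K) g T /\ L = arc_length g 0 T.

(* The closed angular sector with vertex [P] and opening [w] whose first side
   has direction [phi]. *)
Definition sector (R : realType) (P : plane R) (phi w : R) : set (plane R) :=
  [set X | exists rho t, [/\ 0 <= rho, phi <= t <= phi + w
                           & X = (P.1 + rho * cos t, P.2 + rho * sin t)]].

(* The opening of the smallest sector with vertex [P] containing [K]. The set
   is never empty, since an opening of [2 * pi] covers the plane. *)
Definition visual_angle (R : realType) (K : set (plane R)) (P : plane R) : R :=
  inf [set w | 0 <= w /\ exists phi, K `<=` sector P phi w].

Definition isotopic_set (R : realType) (K : set (plane R)) (alpha : R) :
    set (plane R) :=
  [set P | ~ K P /\ visual_angle K P = alpha].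

(* Main.v *)
Require Import Defs.
From HB Require Import structures.
From mathcomp Require Import all_boot all_order all_algebra.
From mathcomp Require Import all_classical all_reals all_analysis.
From mathcomp Require Import ring lra zify.
Set Implicit Arguments.
Unset Strict Implicit.
Unset Printing Implicit Defensive.
Import Order.TTheory GRing.Theory Num.Theory.
Import numFieldNormedType.Exports.
Local Open Scope classical_set_scope.
Local Open Scope ring_scope.

(* Let [h] be the support function of [K] relative to the centre [c] of the
   circle, and [u t = (cos t, sin t)]. The support lines of [K] with normals
   [u t] and [u (t + pi - alpha)] meet at a point [P] outside [K] (the boundary
   has no corners) from which [K] is seen under the angle [alpha], so [P] is on
   the circle and, adding the two equations of the lines,
   [h t + h (t + pi - alpha) = <P - c, u t + u (t + pi - alpha)>
      <= 2 * r * sin (alpha / 2)].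
   Averaging over [t] bounds [W], the integral of [h] over a period, by
   [2 * pi * r * sin (alpha / 2)]. If [Psi] is a continuous angle of the outer
   normal along the boundary [g], integrating by parts the product of [g'] and
   the unit tangent gives [L = k * W], where [k] is the number of turns of the
   normal. Since [W >= 0], only [k <= 1] has to be shown. *)

(** * Primitives and continuous angles *)

Lemma is_derive1D (R : realType) (f g : R -> R) (x a b : R) :
  is_derive x 1 f a -> is_derive x 1 g b ->
  is_derive x 1 (fun t => f t + g t) (a + b).
Proof. exact: is_deriveD. Qed.

Lemma is_derive1N (R : realType) (f : R -> R) (x a : R) :
  is_derive x 1 f a -> is_derive x 1 (fun t => - f t) (- a).
Proof. exact: is_deriveN. Qed.

Lemma is_derive1B (R : realType) (f g : R -> R) (x a b : R) :
  is_derive x 1 f a -> is_derive x 1 g b ->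
  is_derive x 1 (fun t => f t - g t) (a - b).
Proof. exact: is_deriveB. Qed.

Lemma is_derive1M (R : realType) (f g : R -> R) (x a b : R) :
  is_derive x 1 f a -> is_derive x 1 g b ->
  is_derive x 1 (fun t => f t * g t) (a * g x + f x * b).
Proof.
move=> fa gb; apply: is_derive_eq (is_deriveM fa gb) _.
by rewrite /GRing.scale /= addrC mulrC.
Qed.

Lemma is_derive1_compl (R : realType) (f g : R -> R) (x a b : R) :
  is_derive (g x) 1 f a -> is_derive x 1 g b ->
  is_derive x 1 (fun t => f (g t)) (a * b).
Proof. exact: is_derive1_comp. Qed.

Lemma is_derive1_continuous (R : realType) (f : R -> R) (x a : R) :
  is_derive x 1 f a -> {for x, continuous f}.
Proof.
by move=> fa; apply/differentiable_continuous/derivable1_diffP; case: fa.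
Qed.

Lemma is_derive1P (R : realType) (f : R -> R) (x : R) :
  derivable f x 1 -> is_derive x 1 f (derive1 f x).
Proof. by move=> df; rewrite derive1E; exact: derivableP. Qed.

Lemma derive_cst_in (R : realType) (f g : R -> R) (a b : R) :
  (forall x, a < x < b -> is_derive x 1 f (g x)) ->
  (forall x, a < x < b -> g x = 0) ->
  forall x y, a < x < b -> a < y < b -> f x = f y.
Proof.
move=> fg g0; have H x y : a < x < b -> a < y < b -> x <= y -> f x = f y.
  move=> /andP[ax xb] /andP[ay yb] xy.
  have sub z : x <= z <= y -> a < z < b.
    by move=> /andP[xz zy]; rewrite (lt_le_trans ax)// (le_lt_trans zy).
  have [||z zxy] := @MVT_segment R f g x y xy.
  - move=> z; rewrite in_itv/= => /andP[xz zy]; apply: fg; apply: sub.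
    by rewrite !ltW.
  - apply: continuous_in_subspaceT => z; rewrite inE/= in_itv/= => zxy.
    by apply: is_derive1_continuous (fg _ (sub _ zxy)).
  - rewrite g0; last by apply: sub; move: zxy; rewrite in_itv.
    by rewrite mul0r => /eqP; rewrite subr_eq0 => /eqP.
move=> x y axb ayb; have [xy|/ltW yx] := leP x y; first exact: H.
by rewrite -(H y x).
Qed.

(** The fundamental theorem of calculus gives a primitive with base point [- M]. Subtracting its
    value at 0 makes the primitives for different [M] agree wherever both are defined, so that they
    can be glued. *)
Lemma antiderivative_itv (R : realType) (f : R -> R) (M : R) :
  continuous f -> 0 < M ->
  exists F : R -> R, F 0 = 0 /\ forall x : R, - M < x < M -> is_derive x 1 F (f x).
Proof.
move=> cf M0.
pose G x := (\int[lebesgue_measure]_(t in [set` `[- M, x]]) (f t))%R.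
have dG x : - M < x < M -> is_derive x 1 G (f x).
  move=> /andP[Mx xM].
  have [] := @continuous_FTC1_closed R f (- M) x M xM _ Mx (cf x).
    apply: continuous_compact_integrable; first exact: segment_compact.
    exact: continuous_subspaceT.
  by move=> dG <-; exact: is_derive1P.
exists (fun x => G x - G 0); split=> [|x Mx]; first by rewrite subrr.
rewrite -[f x]subr0; exact: is_derive1B (dG _ Mx) _.
Qed.

Lemma antiderivative (R : realType) (f : R -> R) :
  continuous f -> exists F : R -> R, forall x : R, is_derive x 1 F (f x).
Proof.
move=> cf.
have /choice[F FP] : forall n : nat, exists F : R -> R, F 0 = 0 /\
    forall x : R, - n.+1%:R < x < n.+1%:R -> is_derive x 1 F (f x).
  by move=> n; apply: antiderivative_itv.
have FE m n (x : R) : (m <= n)%N -> - m.+1%:R < x < m.+1%:R -> F m x = F n x.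
  move=> mn mx; have H : (m.+1%:R : R) <= n.+1%:R by rewrite ler_nat.
  have: F m x - F n x = F m 0 - F n 0.
    apply: (@derive_cst_in R (fun x => F m x - F n x) (fun x => f x - f x)
      (- m.+1%:R) m.+1%:R) => //.
    - move=> y /andP[y1 y2]; apply: is_derive1B; first by apply: (FP _).2; rewrite y1.
      by apply: (FP _).2; rewrite (le_lt_trans _ y1) ?lerN2// (lt_le_trans y2).
    - by move=> y _; rewrite subrr.
    - by rewrite oppr_lt0 ltr0n.
  by rewrite !(FP _).1 subrr => /eqP; rewrite subr_eq0 => /eqP.
pose N (x : R) := (Num.truncn `|x|).
have Nx x : `|x| < (N x).+1%:R by apply: truncnS_gt.
(* The index [N y] may jump for [y] near [x]. The derivative is therefore taken from [F (N x).+1],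
   which is valid on a whole neighbourhood of [x] and agrees there with [F (N y) y]. *)
exists (fun x => F (N x) x) => x.
have [_ /(_ x)] := FP (N x).+1 => dF.
apply: near_eq_is_derive; last first.
  apply: dF; rewrite -ltr_norml (lt_trans (Nx x))// ltr_nat//.
near=> y.
have yN : `|y| < (N x).+2%:R.
  near: y; have -> : (N x).+2%:R = (N x).+1%:R + 1 :> R by rewrite -natr1.
  have x1 : 0 < (N x).+2%:R - `|x|.
    by rewrite subr_gt0 (lt_trans (Nx x))// ltr_nat.
  exists ((N x).+2%:R - `|x|) => //= y /=; rewrite ltrBrDr natr1.
  apply: le_lt_trans; rewrite distrC addrC -lerBlDl.
  by rewrite (le_trans _ (lerB_dist _ _)).
have [le|/ltnW le] := leqP (N y) (N x).+1.
  by rewrite (FE _ _ _ le)// -ltr_norml.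
by rewrite -(FE _ _ _ le)// -ltr_norml.
Unshelve. all: by end_near. Qed.

Lemma unit_vector_angle (R : realType) (a b : R) :
  a ^+ 2 + b ^+ 2 = 1 ->
  exists theta, [/\ - pi <= theta <= pi, a = cos theta & b = sin theta].
Proof.
move=> ab1.
have a1 : -1 <= a <= 1 by apply/andP; split; nra.
have [ac0 acpi] := (acos_ge0 a1, acos_lepi a1).
have [b0|/ltW b0] := leP 0 b.
  exists (acos a); rewrite acosK// sin_acos//; split=> //.
  by apply/andP; split; lra.
  have -> : 1 - a ^+ 2 = b ^+ 2 by rewrite -ab1; ring.
  by rewrite sqrtr_sqr ger0_norm.
exists (- acos a); rewrite cosN sinN acosK// sin_acos//; split=> //.
  by apply/andP; split; lra.
have -> : 1 - a ^+ 2 = b ^+ 2 by rewrite -ab1; ring.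
by rewrite sqrtr_sqr ler0_norm// opprK.
Qed.

(** An angle of [(a, b)] must have derivative [a * db - b * da], so [theta] is a primitive of that
    expression with the right value at 0. The inner product of [(a, b)] and [(cos theta, sin theta)]
    is then constantly 1, and two unit vectors with inner product 1 coincide. *)
Lemma unit_angle_lift (R : realType) (a b da db : R -> R) :
  (forall t : R, is_derive t 1 a (da t)) ->
  (forall t : R, is_derive t 1 b (db t)) ->
  continuous da -> continuous db ->
  (forall t, a t ^+ 2 + b t ^+ 2 = 1) ->
  exists theta kappa : R -> R,
    (forall t : R, is_derive t 1 theta (kappa t)) /\
    forall t, a t = cos (theta t) /\ b t = sin (theta t).
Proof.
move=> ha hb cda cdb ab1.
have ca t : {for t, continuous a} by apply: is_derive1_continuous (ha t).
have cb t : {for t, continuous b} by apply: is_derive1_continuous (hb t).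
pose kappa t := a t * db t - b t * da t.
have ckappa : continuous kappa.
  by move=> t; apply: cvgB; apply: cvgM; [exact: ca|exact: cdb|exact: cb|exact: cda].
have [theta1 htheta1] := antiderivative ckappa.
have [theta0 [_ a0 b0]] := unit_vector_angle (ab1 0).
pose theta t := theta1 t + (theta0 - theta1 0).
have htheta (t : R) : is_derive t 1 theta (kappa t).
  rewrite -[kappa t]addr0; exact: is_derive1D.
exists theta, kappa; split=> // t.
have orth s : a s * da s + b s * db s = 0.
  have h1 : is_derive s 1 (fun t => a t * a t + b t * b t)
      ((da s * a s + a s * da s) + (db s * b s + b s * db s)).
    by apply: is_derive1D; apply: is_derive1M.
  have h2 : is_derive s 1 (fun t => a t * a t + b t * b t) 0.
    have -> : (fun t => a t * a t + b t * b t) = cst 1.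
      by apply/funext => u; rewrite -!expr2 ab1.
    exact: is_derive_cst.
  move: h1 h2 => [_ h1] [_ h2]; move: h1; rewrite h2; lra.
have hcos (s : R) : is_derive s 1 (fun t => cos (theta t)) (- sin (theta s) * kappa s).
  exact: is_derive1_compl.
have hsin (s : R) : is_derive s 1 (fun t => sin (theta t)) (cos (theta s) * kappa s).
  exact: is_derive1_compl.
pose v s := a s * cos (theta s) + b s * sin (theta s).
have v1 : v t = 1.
  have -> : v t = v 0.
    apply: is_derive_0_is_cst => s.
    have -> : 0 = da s * cos (theta s) + a s * (- sin (theta s) * kappa s) +
        (db s * sin (theta s) + b s * (cos (theta s) * kappa s)).
      have e1 : da s = - b s * kappa s.
        rewrite /kappa; transitivity ((a s ^+ 2 + b s ^+ 2) * da s).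
          by rewrite ab1 mul1r.
        transitivity (a s * (a s * da s + b s * db s) - b s * kappa s).
          by rewrite /kappa; ring.
        by rewrite orth /kappa; ring.
      have e2 : db s = a s * kappa s.
        rewrite /kappa; transitivity ((a s ^+ 2 + b s ^+ 2) * db s).
          by rewrite ab1 mul1r.
        transitivity (b s * (a s * da s + b s * db s) + a s * kappa s).
          by rewrite /kappa; ring.
        by rewrite orth /kappa; ring.
      by rewrite e1 e2; ring.
    by apply: is_derive1D; apply: is_derive1M.
  rewrite /v /theta addrCA subrr addr0 -a0 -b0 -!expr2; exact: ab1.
have : (a t - cos (theta t)) ^+ 2 + (b t - sin (theta t)) ^+ 2 = 0.
  transitivity ((a t ^+ 2 + b t ^+ 2) + (cos (theta t) ^+ 2 + sin (theta t) ^+ 2) - 2 * v t).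
    by rewrite /v; ring.
  by rewrite ab1 cos2Dsin2 v1; ring.
move/eqP; rewrite paddr_eq0 ?sqr_ge0// !sqrf_eq0 !subr_eq0.
by move=> /andP[/eqP -> /eqP ->].
Qed.

(** Dividing by the norm [rho], which is differentiable because it never vanishes, reduces this to
    unit vectors. *)
Lemma angle_lift (R : realType) (p q dp dq : R -> R) :
  (forall t : R, is_derive t 1 p (dp t)) ->
  (forall t : R, is_derive t 1 q (dq t)) ->
  continuous dp -> continuous dq ->
  (forall t, 0 < p t ^+ 2 + q t ^+ 2) ->
  exists theta kappa : R -> R,
    (forall t : R, is_derive t 1 theta (kappa t)) /\
    forall t, p t = Num.sqrt (p t ^+ 2 + q t ^+ 2) * cos (theta t) /\
              q t = Num.sqrt (p t ^+ 2 + q t ^+ 2) * sin (theta t).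
Proof.
move=> hp hq cdp cdq pq0.
have cp t : {for t, continuous p} by apply: is_derive1_continuous (hp t).
have cq t : {for t, continuous q} by apply: is_derive1_continuous (hq t).
pose n t := p t * p t + q t * q t.
have nE t : n t = p t ^+ 2 + q t ^+ 2 by rewrite /n !expr2.
have n0 t : 0 < n t by rewrite nE.
pose rho t := Num.sqrt (n t).
have rho0 t : 0 < rho t by rewrite sqrtr_gt0.
have rhoE t : rho t ^+ 2 = n t by rewrite sqr_sqrtr// ltW.
pose drho t := (2 * rho t)^-1 * ((dp t * p t + p t * dp t) + (dq t * q t + q t * dq t)).
have hrho (t : R) : is_derive t 1 rho (drho t).
  apply: (@is_derive1_compl R Num.sqrt n t (2 * rho t)^-1).
    exact: is_derive1_sqrt.
  by apply: is_derive1D; apply: is_derive1M.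
have crho t : {for t, continuous rho} by apply: is_derive1_continuous (hrho t).
have cdrho : continuous drho.
  move=> t; apply: cvgM.
    apply: cvgV; first by rewrite mulf_neq0// gt_eqF.
    by apply: cvgM; [exact: cvg_cst|exact: crho].
  by apply: cvgD; apply: cvgD; apply: cvgM;
    [exact: cdp|exact: cp|exact: cp|exact: cdp|exact: cdq|exact: cq|exact: cq|exact: cdq].
pose div_deriv (f df : R -> R) t := df t * (rho t)^-1 + f t * (- (rho t)^-2 * drho t).
have hdiv (f df : R -> R) (t : R) : is_derive t 1 f (df t) ->
    is_derive t 1 (fun s => f s * (rho s)^-1) (div_deriv f df t).
  move=> hf; apply: is_derive1M => //.
  by apply: is_deriveV => //; rewrite gt_eqF.
have cdiv (f df : R -> R) : continuous f -> continuous df ->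
    continuous (div_deriv f df).
  move=> cf cdf t; have ci : (rho s)^-1 @[s --> t] --> (rho t)^-1.
    by apply: cvgV; [rewrite gt_eqF|exact: crho].
  apply: cvgD; apply: cvgM; [exact: cdf|exact: ci|exact: cf|].
  apply: cvgM; [apply: cvgN|exact: cdrho].
  apply: cvgV; first by rewrite sqrf_eq0 gt_eqF.
  by rewrite expr2; under eq_fun do rewrite expr2; apply: cvgM; exact: crho.
have [|||theta [kappa [htheta E]]] := @unit_angle_lift R
  (fun s => p s * (rho s)^-1) (fun s => q s * (rho s)^-1)
  (div_deriv p dp) (div_deriv q dq).
- exact: cdiv.
- exact: cdiv.
- by move=> t; rewrite !exprMn -mulrDl -nE exprVn rhoE divff// gt_eqF.
exists theta, kappa; split=> // t; have [<- <-] := E t.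
by rewrite -nE -/(rho t); split; rewrite mulrCA divff ?mulr1// gt_eqF.
Qed.

(** * Integrals, full turns and periodicity *)

Lemma Rintegral_FTC2 (R : realType) (f F : R -> R) (a b : R) : a < b ->
  continuous f -> (forall x : R, is_derive x 1 F (f x)) ->
  (\int[lebesgue_measure]_(t in `[a, b]) f t)%R = F b - F a.
Proof.
move=> ab cf dF.
have cF : continuous F by move=> x; apply: is_derive1_continuous (dF x).
rewrite /Rintegral (@continuous_FTC2 R f F)//.
- exact: continuous_subspaceT.
- split=> [x _||]; first by case: (dF x).
    exact/cvg_at_right_filter/cF.
  exact/cvg_at_left_filter/cF.
- by move=> x _; rewrite derive1E; case: (dF x).
Qed.

Lemma is_derive_le0_nincr (R : realType) (f g : R -> R) (x y : R) :
  (forall t : R, is_derive t 1 f (g t)) -> (forall t, g t <= 0) ->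
  x <= y -> f y <= f x.
Proof.
move=> fg g0 xy.
have [|z _] := @MVT_segment R f g x y xy.
  apply: continuous_subspaceT => t; exact: is_derive1_continuous (fg t).
by move=> fE; rewrite -subr_le0 fE mulr_le0_ge0// subr_ge0.
Qed.

(** Removing the whole turns from [y - x] leaves a remainder [z] in [[0, 2 * pi)] with [cos z = 1].
    Hence [sin (z / 2) = 0] with [z / 2] in [[0, pi)], and [z = 0]. *)
Lemma same_direction_turns (R : realType) (x y : R) :
  cos x = cos y -> sin x = sin y -> exists k : int, y = x + k%:~R * (2 * pi).
Proof.
move=> cxy sxy; have pi0 := @pi_gt0 R.
have pi20 : 0 < 2 * pi :> R by lra.
have cos1 : cos (y - x) = 1 by rewrite cosB cxy sxy -!expr2 cos2Dsin2.
pose k := Num.floor ((y - x) / (2 * pi)).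
exists k.
have k1 : k%:~R * (2 * pi) <= y - x by rewrite -ler_pdivlMr// ge_floor.
have k2 : y - x < (k + 1)%:~R * (2 * pi) by rewrite -ltr_pdivrMr// floorD1_gt.
rewrite intrD mulrDl mul1r in k2.
pose z := (y - x - k%:~R * (2 * pi)).
have z0 : 0 <= z < 2 * pi by rewrite /z; lra.
have perE (j : int) (t : R) : cos (t + j%:~R * (2 * pi)) = cos t.
  have natP (n : nat) (u : R) : cos (u + n%:R * (2 * pi)) = cos u.
    have -> : n%:R * (2 * pi) = (pi *+ 2) *+ n :> R.
      by rewrite -[pi *+ 2]mulr_natl mulr_natl.
    exact: (periodicn (@cosD2pi R)).
  case: j => n; first exact: natP.
  by rewrite NegzE mulrNz -[in RHS](subrK (n.+1%:R * (2 * pi)) t) natP mulNr.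
have : cos z = 1.
  by rewrite -cos1 -(perE k z) /z subrK.
have -> : z = (z / 2) *+ 2 by rewrite -mulr_natr divfK.
rewrite cos_mulr2n cos2sin2 => /eqP sz.
have {}sz : sin (z / 2) = 0.
  by apply/eqP; rewrite -sqrf_eq0; apply/eqP; move/eqP: sz; lra.
have : z = 0.
  apply/eqP; rewrite eq_le (andP z0).1 andbT leNgt; apply/negP => zgt.
  have : 0 < sin (z / 2) by apply: sin_gt0_pi; lra.
  by rewrite sz ltxx.
rewrite /z; lra.
Qed.

(** [W] is the integral of [h] over a period. The function [Q t + Q (t + pi)] grows by [W] over half
    a period, whence [0 <= W]. The function [Q t + Q (t + beta)] grows by [2 * W] over a period, and
    by at most [2 * pi * m]. *)
Lemma periodic_primitive (R : realType) (h Q : R -> R) (beta m : R) :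
  (forall t : R, is_derive t 1 Q (h t)) ->
  (forall t, h (t + 2 * pi) = h t) ->
  (forall t, h t + h (t + beta) <= m) ->
  (forall t, 0 <= h t + h (t + pi)) ->
  exists W, [/\ 0 <= W, W <= pi * m & forall t, Q (t + 2 * pi) = Q t + W].
Proof.
move=> hQ hper hm h0; have pi0 := @pi_gt0 R.
have pi20 : 0 < 2 * pi :> R by lra.
have shiftQ (a t : R) : is_derive t 1 (fun s => Q (s + a)) (h (t + a)).
  rewrite -[h _]mulr1; apply: is_derive1_compl; rewrite -[X in is_derive _ _ _ X]addr0.
  exact: is_derive1D.
pose W := Q (0 + 2 * pi) - Q 0.
have QW t : Q (t + 2 * pi) = Q t + W.
  suff : Q (t + 2 * pi) - Q t = W by lra.
  apply: (@is_derive_0_is_cst R (fun t => Q (t + 2 * pi) - Q t) t 0) => s.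
  by rewrite -(subrr (h s)) -{1}(hper s); apply: is_derive1B.
exists W; split=> //.
- have := @is_derive_le0_nincr R (fun t => - (Q t + Q (t + pi)))
    (fun t => - (h t + h (t + pi))) 0 pi.
  have -> : pi + pi = 0 + 2 * pi :> R by ring.
  rewrite QW add0r => H.
  have : - (Q pi + (Q 0 + W)) <= - (Q 0 + Q pi).
    by apply: (H _ _ (ltW pi0)) => t; rewrite oppr_le0.
  lra.
- have := @is_derive_le0_nincr R (fun t => (Q t + Q (t + beta)) - m * t)
    (fun t => (h t + h (t + beta)) - m) 0 (2 * pi).
  have -> : 2 * pi + beta = beta + 2 * pi :> R by ring.
  rewrite -[in Q (2 * pi)](add0r (2 * pi)) !QW add0r mulr0 subr0 => H.
  have dH (t : R) : is_derive t 1 (fun t => (Q t + Q (t + beta)) - m * t)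
      ((h t + h (t + beta)) - m).
    apply: is_derive1B.
    by have := is_derive1M (is_derive_cst m t 1) (is_derive_id t 1);
      rewrite mul0r add0r mulr1.
  have : Q 0 + W + (Q beta + W) - m * (2 * pi) <= Q 0 + Q beta.
    by apply: (H dH _ (ltW pi20)) => t; rewrite subr_le0.
  lra.
Qed.

Lemma periodic_primitive_turns (R : realType) (Q : R -> R) (W : R) (k : int) (t : R) :
  (forall t, Q (t + 2 * pi) = Q t + W) ->
  Q (t + k%:~R * (2 * pi)) = Q t + k%:~R * W.
Proof.
move=> QW; have natP (n : nat) (u : R) : Q (u + n%:R * (2 * pi)) = Q u + n%:R * W.
  elim: n u => [|n IH] u; first by rewrite !mul0r !addr0.
  have -> : u + n.+1%:R * (2 * pi) = u + n%:R * (2 * pi) + 2 * pi.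
    by rewrite -natr1; ring.
  by rewrite QW IH -natr1; ring.
case: k => n; first exact: natP.
rewrite NegzE mulrNz -[in RHS](subrK (n.+1%:R * (2 * pi)) t) natP !mulNr; ring.
Qed.

(** * Support functions of plane convex sets *)

Definition dotp (R : realType) (c X : plane R) (phi : R) : R :=
  (X.1 - c.1) * cos phi + (X.2 - c.2) * sin phi.

(** The maximum is required to be attained, so that every direction comes with a support point. *)
Definition support_function (R : realType) (K : set (plane R)) (c : plane R)
    (h : R -> R) : Prop :=
  forall phi, (exists2 A, K A & dotp c A phi = h phi) /\
              (forall X, K X -> dotp c X phi <= h phi).

Lemma fst_plane_continuous (R : realType) : continuous (fun X : plane R => (X.1 : R)).
Proof. by move=> X; exact: cvg_fst. Qed.

Lemma snd_plane_continuous (R : realType) : continuous (fun X : plane R => (X.2 : R)).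
Proof. by move=> X; exact: cvg_snd. Qed.

Lemma dotp_continuous (R : realType) (c : plane R) (phi : R) :
  continuous (fun X => dotp c X phi).
Proof.
move=> X; apply: cvgD; apply: cvgM; try exact: cvg_cst; apply: cvgB; try exact: cvg_cst.
  exact: fst_plane_continuous.
exact: snd_plane_continuous.
Qed.

Lemma support_function_exists (R : realType) (K : set (plane R)) (c : plane R) :
  compact K -> K !=set0 -> exists h, support_function K c h.
Proof.
move=> cK K0.
have /choice[h hP] : forall phi, exists v : R, (exists2 A, K A & dotp c A phi = v) /\
    forall X, K X -> dotp c X phi <= v.
  move=> phi; have [|A] := @compact_EVT_max _ R (fun X => dotp c X phi) K K0 cK.
    by apply: continuous_subspaceT; exact: dotp_continuous.
  rewrite inE => KA Amax; exists (dotp c A phi); split; first by exists A.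
  by move=> X KX; apply: Amax; rewrite inE.
by exists h.
Qed.

Lemma support_function_direction (R : realType) (K : set (plane R)) (c : plane R) h
    (phi psi : R) :
  support_function K c h -> cos phi = cos psi -> sin phi = sin psi -> h phi = h psi.
Proof.
move=> hK cE sE.
suff le a b : cos a = cos b -> sin a = sin b -> h a <= h b.
  by apply/eqP; rewrite eq_le !le.
move=> cab sab; have [[A KA <-] _] := hK a.
by rewrite /dotp cab sab; apply: (hK b).2.
Qed.

(** By compactness the coordinates of points of [K] relative to [c] are bounded by a constant
    [M + 1]. Testing a support point for [a] in the direction [b] then bounds [h a - h b] by this
    constant times the variation of cosine and sine. *)
Lemma support_function_continuous (R : realType) (K : set (plane R)) (c : plane R) h :
  compact K -> support_function K c h -> continuous h.
Proof.
move=> cK hK.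
have K0 : K !=set0 by have [[A KA _] _] := hK 0; exists A.
have [|B _ Bmax] := @compact_EVT_max _ R
    (fun X => (X.1 - c.1) ^+ 2 + (X.2 - c.2) ^+ 2) K K0 cK.
  apply: continuous_subspaceT => X; under eq_fun do rewrite !expr2.
  by apply: cvgD; apply: cvgM; apply: cvgB; (try exact: cvg_cst);
    (exact: fst_plane_continuous || exact: snd_plane_continuous).
set M := (B.1 - c.1) ^+ 2 + (B.2 - c.2) ^+ 2 in Bmax.
have coordM X : K X -> `|X.1 - c.1| <= M + 1 /\ `|X.2 - c.2| <= M + 1.
  move=> KX; have := Bmax X; rewrite inE => /(_ KX) XM.
  have sqr_bound (x : R) : `|x| <= x ^+ 2 + 1.
    by rewrite ler_norml; apply/andP; split; nra.
  split; apply: le_trans (sqr_bound _) _; rewrite lerD2r;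
    by apply: le_trans XM; rewrite ?lerDl ?lerDr sqr_ge0.
have M0 : 0 <= M by apply: addr_ge0; exact: sqr_ge0.
have lip a b : h a - h b <= (M + 1) * (`|cos a - cos b| + `|sin a - sin b|).
  have [[A KA <-] _] := hK a; have [c1 c2] := coordM A KA.
  have -> : dotp c A a - h b = (A.1 - c.1) * (cos a - cos b) +
      (A.2 - c.2) * (sin a - sin b) + (dotp c A b - h b) by rewrite /dotp; ring.
  rewrite -[X in _ <= X]addr0 lerD//; last by rewrite subr_le0 (hK b).2.
  rewrite [X in _ <= X]mulrDr.
  by apply: lerD; rewrite (le_trans (ler_norm _))// normrM ler_wpM2r.
move=> a; apply/cvgrPdist_le => e e0.
have c0 : (M + 1) * (`|cos a - cos b| + `|sin a - sin b|) @[b --> a] --> (0 : R).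
  have -> : (0 : R) = (M + 1) * (`|cos a - cos a| + `|sin a - sin a|).
    by rewrite !subrr normr0 addr0 mulr0.
  apply: cvgM; first exact: cvg_cst.
  apply: cvgD; apply: cvg_norm; apply: cvgB; try exact: cvg_cst.
    exact: continuous_cos.
  exact: continuous_sin.
move/cvgrPdist_le : c0 => /(_ e e0); apply: filterS => b /=.
rewrite sub0r normrN => /(le_trans (ler_norm _)) ble.
rewrite ler_norml; apply/andP; split; last exact: le_trans (lip a b) ble.
rewrite lerNl opprB (le_trans (lip b a))//.
by rewrite (distrC (cos b)) (distrC (sin b)).
Qed.


Lemma plane_ball (R : realType) (A B : plane R) (e : R) :
  `|A.1 - B.1| < e -> `|A.2 - B.2| < e -> ball A e B.
Proof. by move=> e1 e2; split; rewrite -ball_normE. Qed.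

Lemma plane_ballE (R : realType) (A B : plane R) (e : R) :
  ball A e B -> `|A.1 - B.1| < e /\ `|A.2 - B.2| < e.
Proof. by case; rewrite -!ball_normE. Qed.

(** A small step from [A] along the normal pushes [dotp] above its maximum on [K], so no ball around
    [A] is contained in [K]. *)
Lemma support_point_frontier (R : realType) (K : set (plane R)) (c : plane R) h A phi :
  support_function K c h -> K A -> dotp c A phi = h phi -> frontier K A.
Proof.
move=> hK KA Ah; split; first exact: subset_closure.
move=> /nbhs_ballP[e /= e0 eK].
have small (a : R) : `|a| <= 1 -> `|e / 2 * a| < e.
  by move=> a1; rewrite normrM ger0_norm; nra.
have /eK/(hK phi).2 : ball A e (A.1 + e / 2 * cos phi, A.2 + e / 2 * sin phi).
  by apply: plane_ball => /=; rewrite opprD addrA subrr sub0r normrN small//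
    ?cos_max ?sin_max.
rewrite -Ah /dotp /=; have := cos2Dsin2 phi; nra.
Qed.

Lemma convex_plane (R : realType) (K : set (plane R)) (X Y : plane R) (s : R) :
  convex_set K -> K X -> K Y -> 0 <= s <= 1 ->
  K (X.1 + s * (Y.1 - X.1), X.2 + s * (Y.2 - X.2)).
Proof.
move=> cvxK KX KY s01.
have := @cvxK Y X (@Itv01 R s (andP s01).1 (andP s01).2); rewrite !inE => /(_ KY KX).
congr (K _).
have E (x y : R) : x + s * (y - x) = s * y + (1 - s) * x by ring.
by rewrite !E.
Qed.

(** The separating normal points from the point [B] of [K] nearest to [q] towards [q]: by convexity,
    [X - B] makes no acute angle with it for [X] in [K]. *)
Lemma separate_point (R : realType) (K : set (plane R)) (c q : plane R) h :
  compact K -> convex_set K -> support_function K c h -> ~ K q ->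
  exists phi, h phi < dotp c q phi.
Proof.
move=> cK cvxK hK Kq.
have K0 : K !=set0 by have [[A KA _] _] := hK 0; exists A.
have [|B] := @compact_EVT_min _ R
    (fun X => (X.1 - q.1) ^+ 2 + (X.2 - q.2) ^+ 2) K K0 cK.
  apply: continuous_subspaceT => X; under eq_fun do rewrite !expr2.
  by apply: cvgD; apply: cvgM; apply: cvgB; (try exact: cvg_cst);
    (exact: fst_plane_continuous || exact: snd_plane_continuous).
rewrite inE => KB Bmin.
pose u := q.1 - B.1; pose v := q.2 - B.2.
have d20 : 0 < u ^+ 2 + v ^+ 2.
  rewrite lt_neqAle addr_ge0 ?sqr_ge0// andbT eq_sym paddr_eq0 ?sqr_ge0//.
  rewrite !sqrf_eq0 !subr_eq0; apply/negP => /andP[/eqP q1 /eqP q2].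
  by apply: Kq; rewrite (surjective_pairing q) q1 q2 -surjective_pairing.
pose d := Num.sqrt (u ^+ 2 + v ^+ 2).
have d0 : 0 < d by rewrite sqrtr_gt0.
have dE : d ^+ 2 = u ^+ 2 + v ^+ 2 by rewrite sqr_sqrtr// ltW.
have [|phi [_ cE sE]] := @unit_vector_angle R (u / d) (v / d).
  by rewrite !expr_div_n -mulrDl -dE divff// sqrf_eq0 gt_eqF.
have {}cE : u = d * cos phi by rewrite -cE mulrCA divff ?mulr1// gt_eqF.
have {}sE : v = d * sin phi by rewrite -sE mulrCA divff ?mulr1// gt_eqF.
have obtuse X : K X -> (X.1 - B.1) * u + (X.2 - B.2) * v <= 0.
  move=> KX; rewrite leNgt; apply/negP => s0.
  set s := (_ + _) in s0; pose n := (X.1 - B.1) ^+ 2 + (X.2 - B.2) ^+ 2.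
  have n0 : 0 <= n by rewrite addr_ge0 ?sqr_ge0.
  have sn0 : 0 < s + n by rewrite ltr_wpDr.
  (* Moving from [B] towards [X] by the fraction [l] changes the squared distance to [q] by
     [l * (l * n - 2 * s)]. This choice of [l] lies in [[0, 1]] and makes the change negative,
     against the minimality of [B]. *)
  pose l := s / (s + n).
  have l01 : 0 <= l <= 1.
    by rewrite divr_ge0 ?(ltW s0) ?(ltW sn0)//= ler_pdivrMr// mul1r lerDl.
  have lE : l * (s + n) = s by rewrite divfK// gt_eqF.
  have l0 : 0 < l by rewrite divr_gt0.
  have := Bmin (B.1 + l * (X.1 - B.1), B.2 + l * (X.2 - B.2)).
  rewrite inE => /(_ (convex_plane cvxK KB KX l01)) /=.
  have -> : (B.1 + l * (X.1 - B.1) - q.1) ^+ 2 + (B.2 + l * (X.2 - B.2) - q.2) ^+ 2 =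
    (B.1 - q.1) ^+ 2 + (B.2 - q.2) ^+ 2 + l * (l * n - 2 * s).
    by rewrite /n /s /u /v; ring.
  rewrite lerDl pmulr_rge0// => H.
  have := mulr_ge0 (ltW l0) (ltW s0); move: lE; rewrite [l * (s + n)]mulrDr; lra.
exists phi; have [[A KA <-] _] := hK phi.
have := obtuse A KA; rewrite cE sE.
have -> : (A.1 - B.1) * (d * cos phi) + (A.2 - B.2) * (d * sin phi) =
  d * (dotp c A phi - dotp c B phi) by rewrite /dotp; ring.
rewrite pmulr_rle0// subr_le0 => AB; apply: le_lt_trans AB _.
have -> : dotp c q phi = dotp c B phi + (u * cos phi + v * sin phi).
  by rewrite /dotp /u /v; ring.
have -> : u * cos phi + v * sin phi = d.
  by rewrite cE sE -!mulrA -mulrDr -!expr2 cos2Dsin2 mulr1.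
by rewrite ltrDl.
Qed.

(** Otherwise the gap [h - dotp c P] has a positive minimum [e] over all directions. A point within
    [e / 2] of [P] in both coordinates has [dotp] larger by at most [e], so it cannot be separated
    from [K]. This puts a whole ball in [K]. *)
Lemma frontier_supported (R : realType) (K : set (plane R)) (c P : plane R) h :
  compact K -> convex_set K -> support_function K c h -> frontier K P ->
  exists phi, dotp c P phi = h phi.
Proof.
move=> cK cvxK hK [clP nintP].
have ch := support_function_continuous cK hK.
have KP : K P by move: clP; rewrite -(proj1 (closure_id K))//; apply: compact_closed cK.
have cdot : continuous (fun phi => h phi - dotp c P phi).
  move=> t; apply: cvgB; first exact: ch.
  apply: cvgD; apply: cvgM; try exact: cvg_cst; first exact: continuous_cos.
  exact: continuous_sin.
have pi0 := @pi_gt0 R.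
have [||phi _ phimin] := @EVT_min R (fun phi => h phi - dotp c P phi) (- pi) pi.
- lra.
- exact: continuous_subspaceT.
exists phi; apply/eqP; rewrite eq_le (hK phi).2//= leNgt; apply/negP => hlt.
pose e := h phi - dotp c P phi; have e0 : 0 < e by rewrite subr_gt0.
have [q [Pq Kq]] : exists q, ball P (e / 2) q /\ ~ K q.
  apply: contrapT => /forallNP H; apply: nintP; apply/nbhs_ballP.
  exists (e / 2) => /=; first by rewrite divr_gt0.
  by move=> q Pq; apply: contrapT => Kq; exact: (H q).
have [psi0] := separate_point cK cvxK hK Kq.
have [psi [psipi cE sE]] := unit_vector_angle (cos2Dsin2 psi0).
rewrite (support_function_direction hK cE sE).
have -> : dotp c q psi0 = dotp c q psi by rewrite /dotp cE sE.
have [q1 q2] := plane_ballE Pq.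
have : e <= h psi - dotp c P psi by apply: phimin; rewrite in_itv.
have : dotp c q psi - dotp c P psi <= e.
  have -> : dotp c q psi - dotp c P psi =
      (q.1 - P.1) * cos psi + (q.2 - P.2) * sin psi by rewrite /dotp; ring.
  have half (x y : R) : `|x| < e / 2 -> `|y| <= 1 -> x * y <= e / 2.
    move=> xe y1; rewrite (le_trans (ler_norm _))// normrM.
    by rewrite -[e / 2]mulr1 ler_pM// ltW.
  rewrite distrC in q1; rewrite distrC in q2.
  have := half _ _ q1 (cos_max psi); have := half _ _ q2 (sin_max psi); lra.
lra.
Qed.

(** * Visual angles *)

Lemma sector_directionE (R : realType) (a rho s t : R) :
  0 < a -> 0 <= rho -> rho * cos t = a * cos s -> rho * sin t = a * sin s ->
  cos t = cos s /\ sin t = sin s.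
Proof.
move=> a0 rho0 cE sE.
have rhoa : rho = a.
  have : rho ^+ 2 = a ^+ 2.
    rewrite -[LHS]mulr1 -[RHS]mulr1 -{1}(cos2Dsin2 t) -(cos2Dsin2 s).
    by rewrite !mulrDr -!exprMn cE sE.
  move/eqP; rewrite eqrXn2//; [by move/eqP|exact: ltW].
have an0 : a != 0 by rewrite gt_eqF.
by move: cE sE; rewrite rhoa => /(mulfI an0) -> /(mulfI an0) ->.
Qed.

(** The two conditions place the direction in the half circles centred at [pi] and at [beta + pi];
    their intersection is the stated window. A negative [theta] is first moved by a full turn. *)
Lemma supporting_angle_window (R : realType) (theta beta : R) :
  - pi <= theta <= pi -> 0 < beta < pi -> cos theta <= 0 -> cos (theta - beta) <= 0 ->
  exists t, [/\ beta + pi / 2 <= t <= 3 * (pi / 2), cos t = cos theta & sin t = sin theta].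
Proof.
move=> thetapi betapi c1 c2; have pi0 := @pi_gt0 R.
have : exists t, [/\ 0 <= t <= 3 * (pi / 2), cos t = cos theta & sin t = sin theta].
  have [t0|t0] := leP 0 theta; first by exists theta; split=> //; lra.
  exists (theta + pi *+ 2); rewrite cosD2pi sinD2pi; split=> //.
  rewrite -mulr_natl; apply/andP; split; first lra.
  rewrite leNgt; apply/negP => H.
  have : 0 < cos theta by apply: cos_gt0_pihalf; lra.
  lra.
move=> [t [t0 cE sE]]; exists t; split=> //.
have tpi2 : pi / 2 <= t.
  rewrite leNgt; apply/negP => H.
  have : 0 < cos t by apply: cos_gt0_pihalf; lra.
  rewrite cE; lra.
apply/andP; split; last by case/andP: t0.
rewrite leNgt; apply/negP => H.
have : 0 < cos (t - beta) by apply: cos_gt0_pihalf; lra.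
by rewrite cosB cE sE -cosB; lra.
Qed.

Section VisualAngle.
Context (R : realType) (K : set (plane R)) (c P : plane R) (h : R -> R).
Context (phi beta : R).
Context (hK : support_function K c h) (betapi : 0 < beta < pi) (KP : ~ K P).
Context (P1 : dotp c P phi = h phi) (P2 : dotp c P (phi + beta) = h (phi + beta)).

Let sin_beta : 0 < sin beta. Proof. exact: sin_gt0_pi. Qed.

Let plane_eq (X Y : plane R) : X.1 = Y.1 -> X.2 = Y.2 -> X = Y.
Proof. by case: X Y => [? ?] [? ?] /= -> ->. Qed.

Let rot (v w t : R) : (v * cos t + w * sin t) ^+ 2 + (- v * sin t + w * cos t) ^+ 2 =
  v ^+ 2 + w ^+ 2.
Proof.
transitivity ((v ^+ 2 + w ^+ 2) * (cos t ^+ 2 + sin t ^+ 2)); first by ring.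
by rewrite cos2Dsin2 mulr1.
Qed.

(** [P] is the intersection of the support lines with normal angles [phi] and [phi + beta]. In the
    frame rotated by [phi], [(a, b)] are the coordinates of [X - P], and the two support
    inequalities say that its angle [theta] has [cos theta <= 0] and [cos (theta - beta) <= 0]. *)
Lemma subset_supporting_sector : K `<=` sector P (phi + (beta + pi / 2)) (pi - beta).
Proof.
move=> X KX.
pose v := X.1 - P.1; pose w := X.2 - P.2.
pose a := v * cos phi + w * sin phi; pose b := - v * sin phi + w * cos phi.
have dotB t : dotp c X t - dotp c P t = v * cos t + w * sin t.
  by rewrite /dotp /v /w; ring.
have a0 : a <= 0 by rewrite /a -dotB P1 subr_le0 (hK phi).2.
have b0 : a * cos beta + b * sin beta <= 0.
  have -> : a * cos beta + b * sin beta = v * cos (phi + beta) + w * sin (phi + beta).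
    by rewrite cosD sinD /a /b; ring.
  by rewrite -dotB P2 subr_le0 (hK _).2.
pose n := a ^+ 2 + b ^+ 2.
have n0 : 0 < n.
  rewrite /n rot lt_neqAle addr_ge0 ?sqr_ge0// andbT eq_sym paddr_eq0 ?sqr_ge0//.
  rewrite !sqrf_eq0 !subr_eq0; apply/negP => /andP[/eqP q1 /eqP q2].
  by apply: KP; rewrite -(plane_eq q1 q2).
pose rho := Num.sqrt n.
have rho0 : 0 < rho by rewrite sqrtr_gt0.
have rhoE : rho ^+ 2 = n by rewrite sqr_sqrtr// ltW.
have [|theta [thetapi cE sE]] := @unit_vector_angle R (a / rho) (b / rho).
  by rewrite !expr_div_n -mulrDl -/n -rhoE divff// sqrf_eq0 gt_eqF.
have {}cE : a = rho * cos theta by rewrite -cE mulrCA divff ?mulr1// gt_eqF.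
have {}sE : b = rho * sin theta by rewrite -sE mulrCA divff ?mulr1// gt_eqF.
have [||t [tbeta ct st]] := @supporting_angle_window R theta beta thetapi betapi.
- by move: a0; rewrite cE pmulr_rle0.
- move: b0; rewrite cE sE -!mulrA -mulrDr pmulr_rle0//.
  by rewrite cosB.
exists rho, (phi + t); split; first exact: ltW.
  by apply/andP; split; move: tbeta => /andP[]; lra.
have e1 : rho * cos (phi + t) = v.
  rewrite cosD ct st mulrBr !mulrA [rho * _]mulrC -!mulrA -cE.
  rewrite [rho * _]mulrCA -sE -[RHS](mulr1 v) -(cos2Dsin2 phi) /a /b; ring.
have e2 : rho * sin (phi + t) = w.
  rewrite sinD ct st mulrDr [rho * _]mulrCA -cE [rho * _]mulrCA -sE.
  rewrite -[RHS](mulr1 w) -(cos2Dsin2 phi) /a /b; ring.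
by apply: plane_eq; rewrite /= ?e1 ?e2 /v /w addrC subrK.
Qed.

(** The support points [A] and [B] lie on the two sides of the supporting sector, in the directions
    [phi - pi / 2] and [phi + beta + pi / 2]. A narrower sector would give them angles less than
    [pi - beta] apart with the same cosine as [pi - beta], against injectivity of cosine on
    [[0, pi]]. *)
Lemma supporting_sector_minimal (psi w : R) :
  K `<=` sector P psi w -> pi - beta <= w.
Proof.
move=> Kw; rewrite leNgt; apply/negP => walpha.
have [[A KA Ah] _] := hK phi; have [[B KB Bh] _] := hK (phi + beta).
have coordE (X : plane R) (t : R) : dotp c X t = dotp c P t ->
    exists k, X.1 - P.1 = k * - sin t /\ X.2 - P.2 = k * cos t.
  move=> XP; have X0 : (X.1 - P.1) * cos t + (X.2 - P.2) * sin t = 0.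
    transitivity (dotp c X t - dotp c P t); first by rewrite /dotp; ring.
    by rewrite XP subrr.
  exists (- (X.1 - P.1) * sin t + (X.2 - P.2) * cos t); split.
    transitivity ((X.1 - P.1) * (cos t ^+ 2 + sin t ^+ 2) -
      cos t * ((X.1 - P.1) * cos t + (X.2 - P.2) * sin t)).
      by rewrite X0 cos2Dsin2; ring.
    by ring.
  transitivity ((X.2 - P.2) * (cos t ^+ 2 + sin t ^+ 2) -
      sin t * ((X.1 - P.1) * cos t + (X.2 - P.2) * sin t)).
    by rewrite X0 cos2Dsin2; ring.
  by ring.
have sinbE : sin beta = sin (phi + beta) * cos phi - cos (phi + beta) * sin phi.
  by rewrite -sinB addrC addKr.
have neqP (X : plane R) (k t : R) : K X -> X.1 - P.1 = k * - sin t ->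
    X.2 - P.2 = k * cos t -> k != 0.
  move=> KX x1 x2; apply/eqP => k0; apply: KP.
  rewrite -(@plane_eq X P) //; apply/eqP; rewrite -subr_eq0 ?x1 ?x2 k0 mul0r//.
have [a [A1 A2]] := coordE A phi (etrans Ah (esym P1)).
have [b [B1 B2]] := coordE B _ (etrans Bh (esym P2)).
have a0 : a < 0.
  rewrite lt_neqAle (neqP A a phi)//=.
  have : dotp c A (phi + beta) - dotp c P (phi + beta) <= 0.
    by rewrite P2 subr_le0 (hK _).2.
  have -> : dotp c A (phi + beta) - dotp c P (phi + beta) = a * sin beta.
    transitivity ((A.1 - P.1) * cos (phi + beta) + (A.2 - P.2) * sin (phi + beta)).
      by rewrite /dotp; ring.
    by rewrite A1 A2 sinbE; ring.
  by rewrite pmulr_lle0.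
have b0 : 0 < b.
  rewrite lt_neqAle eq_sym (neqP B b (phi + beta))//=.
  have : dotp c B phi - dotp c P phi <= 0 by rewrite P1 subr_le0 (hK _).2.
  have -> : dotp c B phi - dotp c P phi = - b * sin beta.
    transitivity ((B.1 - P.1) * cos phi + (B.2 - P.2) * sin phi).
      by rewrite /dotp; ring.
    by rewrite B1 B2 sinbE; ring.
  by rewrite pmulr_lle0// oppr_le0.
have [rho1 [t1 [rho10 t1w AE]]] := Kw A KA.
have [rho2 [t2 [rho20 t2w BE]]] := Kw B KB.
rewrite AE /= in A1 A2; rewrite BE /= in B1 B2.
have [||| ct1 st1] := @sector_directionE R (- a) rho1 (phi - pi / 2) t1 _ rho10.
- lra.
- by rewrite cosBpihalf; lra.
- by rewrite sinBpihalf; lra.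
have [|| ct2 st2] := @sector_directionE R b rho2 (phi + beta + pi / 2) t2 b0 rho20.
- by rewrite cosDpihalf; lra.
- by rewrite sinDpihalf; lra.
have : cos `|t1 - t2| = cos (pi - beta).
  rewrite cos_norm cosB ct1 ct2 st1 st2 -cosB.
  have -> : phi - pi / 2 - (phi + beta + pi / 2) = - (beta + pi) by field.
  by rewrite cosN cosDpi addrC cosDpi cosN.
have tw : `|t1 - t2| <= w.
  move/andP: t1w => [? ?]; move/andP: t2w => [? ?].
  by rewrite ler_norml; apply/andP; split; lra.
move/cos_inj => H.
have : `|t1 - t2| = pi - beta.
  move/andP: betapi => [? ?].
  by apply: H; rewrite in_itv/= ?normr_ge0/=; try apply/andP; try split; lra.
lra.
Qed.

Lemma visual_angle_supporting : visual_angle K P = pi - beta.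
Proof.
have [b0 b1] := andP betapi.
apply/eqP; rewrite eq_le; apply/andP; split.
  apply: ge_inf; first by exists 0 => w [].
  split; first lra.
  by exists (phi + (beta + pi / 2)); exact: subset_supporting_sector.
apply: lb_le_inf.
  exists (pi - beta); split; first lra.
  by exists (phi + (beta + pi / 2)); exact: subset_supporting_sector.
by move=> w [_ [psi]]; exact: supporting_sector_minimal.
Qed.

End VisualAngle.

Lemma support_sum_le (R : realType) (K : set (plane R)) (c : plane R) (h : R -> R)
    (alpha r phi : R) :
  support_function K c h -> 0 < alpha < pi -> 0 < r ->
  (forall P s t, K P -> dotp c P s = h s -> dotp c P t = h t -> sin (t - s) = 0) ->
  isotopic_set K alpha = circle c r ->
  h phi + h (phi + (pi - alpha)) <= 2 * r * sin (alpha / 2).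
Proof.
move=> hK alphapi r0 smooth isoE.
pose beta := pi - alpha; have betapi : 0 < beta < pi by rewrite /beta; lra.
have sb : 0 < sin beta by exact: sin_gt0_pi.
pose p := h phi; pose q := h (phi + beta).
(* Cramer's rule for the intersection of the two support lines, whose system has determinant
   [sin beta]. *)
pose P : plane R := (c.1 + (p * sin (phi + beta) - q * sin phi) / sin beta,
  c.2 + (q * cos phi - p * cos (phi + beta)) / sin beta).
have sinbE : sin beta = sin (phi + beta) * cos phi - cos (phi + beta) * sin phi.
  by rewrite -sinB addrC addKr.
have sbn0 : sin beta != 0 by rewrite gt_eqF.
have P1 : dotp c P phi = h phi.
  apply: (mulIf sbn0); rewrite [in RHS]sinbE -/p /dotp /=; field.
  exact: sbn0.
have P2 : dotp c P (phi + beta) = h (phi + beta).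
  apply: (mulIf sbn0); rewrite [in RHS]sinbE -/q /dotp /=; field.
  exact: sbn0.
have KP : ~ K P.
  move=> KP; have := smooth P _ _ KP P1 P2.
  by rewrite addrC addKr => /eqP; rewrite (negPf sbn0).
have : isotopic_set K alpha P.
  split=> //; rewrite (visual_angle_supporting hK betapi KP P1 P2) /beta; ring.
rewrite isoE /circle /edist /= => Pr.
rewrite -P1 -/beta -P2.
set X := P.1 - c.1; set Y := P.2 - c.2.
have XY : X ^+ 2 + Y ^+ 2 = r ^+ 2.
  by rewrite -Pr sqr_sqrtr// addr_ge0 ?sqr_ge0.
(* [m] is the bisector of the two normals: the unit vectors at [m - beta / 2] and [m + beta / 2] add
   up to [2 * cos (beta / 2)] times the one at [m]. *)
pose m := phi + beta / 2.
have -> : dotp c P phi + dotp c P (phi + beta) =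
    2 * cos (beta / 2) * (X * cos m + Y * sin m).
  rewrite /dotp -/X -/Y.
  have -> : phi + beta = m + beta / 2 by rewrite /m; field.
  have -> : phi = m - beta / 2 by rewrite /m; ring.
  rewrite cosB cosD sinB sinD; ring.
have -> : cos (beta / 2) = sin (alpha / 2).
  have -> : beta / 2 = - (alpha / 2 - pi / 2) by rewrite /beta; field.
  by rewrite cosN cosBpihalf.
have sa : 0 < sin (alpha / 2) by apply: sin_gt0_pi; lra.
have : X * cos m + Y * sin m <= r.
  have := cos2Dsin2 m; set C := cos m; set S := sin m => CS.
  have : (X * C + Y * S) ^+ 2 + (Y * C - X * S) ^+ 2 = r ^+ 2.
    transitivity ((X ^+ 2 + Y ^+ 2) * (C ^+ 2 + S ^+ 2)); first by ring.
    by rewrite XY CS mulr1.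
  have := sqr_ge0 (Y * C - X * S); nra.
rewrite -!mulrA ler_pM2l// [r * _]mulrC ler_pM2l//.
Qed.

(** * Convex curves *)

Lemma is_derive1_unique (R : realType) (f : R -> R) (x a b : R) :
  is_derive x 1 f a -> is_derive x 1 f b -> a = b.
Proof. by move=> [_ <-] [_ <-]. Qed.

Lemma dotp_pi (R : realType) (c X : plane R) (phi : R) :
  dotp c X (phi + pi) = - dotp c X phi.
Proof. by rewrite /dotp cosDpi sinDpi; ring. Qed.

Lemma is_derive_dotp (R : realType) (c : plane R) (u v Psi : R -> R) (t du dv dPsi : R) :
  is_derive t 1 u du -> is_derive t 1 v dv -> is_derive t 1 Psi dPsi ->
  is_derive t 1 (fun s => dotp c (u s, v s) (Psi s))
    (du * cos (Psi t) + dv * sin (Psi t) +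
     dPsi * (- (u t - c.1) * sin (Psi t) + (v t - c.2) * cos (Psi t))).
Proof.
move=> hu hv hPsi.
have hcos : is_derive t 1 (fun s => cos (Psi s)) (- sin (Psi t) * dPsi).
  exact: is_derive1_compl.
have hsin : is_derive t 1 (fun s => sin (Psi s)) (cos (Psi t) * dPsi).
  exact: is_derive1_compl.
have sub (w : R -> R) (dw a : R) : is_derive t 1 w dw -> is_derive t 1 (fun s => w s - a) dw.
  by move=> hw; have := is_derive1B hw (is_derive_cst a t 1); rewrite subr0.
have := is_derive1D (is_derive1M (sub _ _ c.1 hu) hcos) (is_derive1M (sub _ _ c.2 hv) hsin).
by congr (is_derive _ _ _ _); ring.
Qed.

Section ConvexCurve.
Context (R : realType) (K : set (plane R)) (c : plane R) (h : R -> R).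
Context (g : R -> plane R) (T : R).
Context (compactK : compact K) (convexK : convex_set K).
Context (hK : support_function K c h) (gK : C2_closed_curve (frontier K) g T).

Let x : R -> R := fst \o g.
Let y : R -> R := snd \o g.

Let T_gt0 : 0 < T. Proof. by case: gK => -[]. Qed.

Let gE t : g t = (x t, y t). Proof. exact: surjective_pairing. Qed.

Let dx (t : R) : is_derive t 1 x (derive1 x t).
Proof. by case: gK => -[_ [dx _ _] _] _ _ _ _; apply: is_derive1P. Qed.

Let dy (t : R) : is_derive t 1 y (derive1 y t).
Proof. by case: gK => -[_ _ [dy _ _]] _ _ _ _; apply: is_derive1P. Qed.

Let ddx (t : R) : is_derive t 1 (derive1 x) (derive1 (derive1 x) t).
Proof. by case: gK => -[_ [_ ddx _] _] _ _ _ _; apply: is_derive1P. Qed.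

Let ddy (t : R) : is_derive t 1 (derive1 y) (derive1 (derive1 y) t).
Proof. by case: gK => -[_ _ [_ ddy _]] _ _ _ _; apply: is_derive1P. Qed.

Let gper t : g (t + T) = g t. Proof. by case: gK. Qed.

Let speed_gt0 t : 0 < derive1 x t ^+ 2 + derive1 y t ^+ 2.
Proof. by case: gK => _ _ /(_ t); rewrite sqrtr_gt0. Qed.

Let KP_frontier (P : plane R) : frontier K P -> K P.
Proof.
move=> [clP _]; move: clP; rewrite -(proj1 (closure_id K))//.
by apply: compact_closed compactK.
Qed.

Let frontier_g t : frontier K (g t).
Proof. by case: gK => _ _ _ _ <-; exists t. Qed.

Let Kg t : K (g t). Proof. exact: KP_frontier. Qed.

Lemma derive1_periodic (f : R -> R) (t : R) :
  (forall s : R, is_derive s 1 f (derive1 f s)) -> (forall s, f (s + T) = f s) ->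
  derive1 f (t + T) = derive1 f t.
Proof.
move=> df fper; apply: (@is_derive1_unique R f t) => //.
have -> : f = fun s => f (s + T) by apply/funext => s; rewrite fper.
rewrite -[X in is_derive _ _ _ X]mulr1; apply: is_derive1_compl.
  by have -> : (fun s => f (s + T)) = f by apply/funext => s; rewrite fper.
rewrite -[X in is_derive _ _ _ X]addr0; exact: is_derive1D.
Qed.

Lemma support_normal_orthogonal (t phi : R) :
  dotp c (g t) phi = h phi -> derive1 x t * cos phi + derive1 y t * sin phi = 0.
Proof.
move=> tphi.
have dt (s : R) := is_derive_dotp c (dx s) (dy s) (is_derive_cst phi s 1).
have H : is_derive t 1 (fun s => dotp c (x s, y s) (cst phi s)) 0.
  apply: (@derive1_at_max R _ (t - 1) (t + 1)).
  - lra.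
  - by move=> s _; case: (dt s).
  - by rewrite in_itv/=; apply/andP; split; lra.
  - by move=> s _ /=; rewrite -!gE tphi (hK phi).2.
by rewrite (is_derive1_unique H (dt t)) mul0r addr0.
Qed.

(** Both normals are orthogonal to the same tangent vector, which is nonzero by regularity, so they
    are parallel. *)
Lemma unique_normal P s t :
  K P -> dotp c P s = h s -> dotp c P t = h t -> sin (t - s) = 0.
Proof.
move=> KP Ps Pt.
have : frontier K P by exact: support_point_frontier hK KP Ps.
case: gK => _ _ _ _ <- [a _ aP]; rewrite -aP in Ps Pt.
have := support_normal_orthogonal Ps; have := support_normal_orthogonal Pt.
set u := derive1 x a; set v := derive1 y a => et es.
have e1 : u * sin (t - s) = 0.
  transitivity ((u * cos s + v * sin s) * sin t - (u * cos t + v * sin t) * sin s).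
    by rewrite sinB; ring.
  by rewrite es et; ring.
have e2 : v * sin (t - s) = 0.
  transitivity ((u * cos t + v * sin t) * cos s - (u * cos s + v * sin s) * cos t).
    by rewrite sinB; ring.
  by rewrite es et; ring.
have : (u ^+ 2 + v ^+ 2) * sin (t - s) = 0.
  transitivity (u * (u * sin (t - s)) + v * (v * sin (t - s))); first by ring.
  by rewrite e1 e2; ring.
by move/eqP; rewrite mulf_eq0 (gt_eqF (speed_gt0 a))/= => /eqP.
Qed.

(** With zero width the whole curve would lie on a line. The coordinate along this line takes the
    same value at 0 and [T], so by Rolle its derivative vanishes somewhere, and with it the
    speed. *)
Lemma width_gt0 (phi : R) : 0 < h phi + h (phi + pi).
Proof.
rewrite ltNge; apply/negP => width.
have flat s : dotp c (g s) phi = h phi.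
  apply/eqP; rewrite eq_le (hK phi).2//=.
  by have := (hK (phi + pi)).2 _ (Kg s); rewrite dotp_pi; lra.
pose f s := - sin phi * x s + cos phi * y s.
have df (s : R) : is_derive s 1 f (- sin phi * derive1 x s + cos phi * derive1 y s).
  have := is_derive1D (is_derive1M (is_derive_cst (- sin phi) s 1) (dx s))
    (is_derive1M (is_derive_cst (cos phi) s 1) (dy s)).
  by rewrite !mul0r !add0r.
have fT : f 0 = f T by rewrite /f /x /y /= -(gper 0) add0r.
have [||s _ fs] := Rolle T_gt0 _ _ fT.
- by move=> s _; case: (df s).
- by apply: continuous_subspaceT => s; exact: is_derive1_continuous (df s).
have := is_derive1_unique fs (df s); have := support_normal_orthogonal (flat s).
set u := derive1 x s; set v := derive1 y s => e1 e2.
have : u ^+ 2 + v ^+ 2 = 0.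
  transitivity ((u * cos phi + v * sin phi) ^+ 2 + (- sin phi * u + cos phi * v) ^+ 2).
    transitivity ((u ^+ 2 + v ^+ 2) * (cos phi ^+ 2 + sin phi ^+ 2)).
      by rewrite cos2Dsin2 mulr1.
    by ring.
  by rewrite e1 -e2; ring.
by have := speed_gt0 s; rewrite -/u -/v => /[swap] ->; rewrite ltxx.
Qed.

(** Some support line passes through [g t]; its normal is orthogonal to the tangent, hence has
    direction [theta] or [theta + pi]. *)
Lemma normal_angle_or_opposite (theta t : R) :
  derive1 x t = - speed g t * sin theta -> derive1 y t = speed g t * cos theta ->
  dotp c (g t) theta = h theta \/ dotp c (g t) (theta + pi) = h (theta + pi).
Proof.
move=> xE yE; have [phi hphi] := frontier_supported compactK convexK hK (frontier_g t).
have s0 : speed g t != 0 by rewrite gt_eqF// sqrtr_gt0; exact: speed_gt0.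
have := support_normal_orthogonal hphi; rewrite xE yE.
have -> : - speed g t * sin theta * cos phi + speed g t * cos theta * sin phi =
    speed g t * sin (phi - theta) by rewrite sinB; ring.
move/eqP; rewrite mulf_eq0 (negPf s0)/= => /eqP sin0.
have cphi : cos phi = cos (phi - theta) * cos theta.
  transitivity (cos ((phi - theta) + theta)); first by rewrite subrK.
  by rewrite [LHS]cosD sin0; ring.
have sphi : sin phi = cos (phi - theta) * sin theta.
  transitivity (sin ((phi - theta) + theta)); first by rewrite subrK.
  by rewrite [LHS]sinD sin0; ring.
have := cos2Dsin2 (phi - theta); rewrite sin0 expr0n addr0 => /eqP.
rewrite sqrf_eq1 => /orP[] /eqP cE; rewrite cE in cphi sphi; [left|right].
- rewrite mul1r in cphi; rewrite mul1r in sphi.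
  by rewrite -(support_function_direction hK cphi sphi) -hphi /dotp cphi sphi.
- rewrite mulN1r -cosDpi in cphi; rewrite mulN1r -sinDpi in sphi.
  by rewrite -(support_function_direction hK cphi sphi) -hphi /dotp cphi sphi.
Qed.

(* [eps] is the orientation of the curve and [Psi] a continuous choice of the
   angle of the outer normal. *)
Definition outer_normal_angle (eps : R) (Psi kappa : R -> R) : Prop :=
  [/\ eps = 1 \/ eps = - 1,
      forall t : R, is_derive t 1 Psi (kappa t),
      forall t, derive1 x t = - eps * speed g t * sin (Psi t),
      forall t, derive1 y t = eps * speed g t * cos (Psi t)
    & forall t, dotp c (g t) (Psi t) = h (Psi t)].

Lemma outer_normal_angle_exists : exists eps Psi kappa, outer_normal_angle eps Psi kappa.
Proof.
have dNx (t : R) : is_derive t 1 (fun s => - derive1 x s) (- derive1 (derive1 x) t).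
  exact: is_derive1N.
have [|||theta [kappa [dtheta E]]] := @angle_lift R (derive1 y) (fun s => - derive1 x s)
    (derive1 (derive1 y)) (fun t => - derive1 (derive1 x) t) ddy dNx.
- by case: gK => -[_ _ []].
- by move=> t; apply: cvgN; case: gK => -[_ [_ _ ] cx _] _ _ _ _; exact: cx.
- by move=> t; rewrite sqrrN addrC; exact: speed_gt0.
have speedE t : Num.sqrt (derive1 y t ^+ 2 + (- derive1 x t) ^+ 2) = speed g t.
  by rewrite sqrrN addrC.
have yE t : derive1 y t = speed g t * cos (theta t) by rewrite -speedE; case: (E t).
have xE t : derive1 x t = - speed g t * sin (theta t).
  by rewrite mulNr -speedE -(proj2 (E t)) opprK.
(* [delta] is negative where [theta] is the outer normal angle and positive where [theta + pi] is.
   It is continuous and never zero, so one of the two choices holds along the whole curve and fixes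
   [eps]. *)
pose delta t := (h (theta t) - dotp c (g t) (theta t)) -
  (h (theta t + pi) - dotp c (g t) (theta t + pi)).
have plus_lt0 t : dotp c (g t) (theta t) = h (theta t) -> delta t < 0.
  move=> e; rewrite /delta dotp_pi e; have := width_gt0 (theta t); lra.
have minus_gt0 t : dotp c (g t) (theta t + pi) = h (theta t + pi) -> 0 < delta t.
  move=> e; rewrite /delta e; rewrite dotp_pi in e; have := width_gt0 (theta t); lra.
have ch := support_function_continuous compactK hK.
have ctheta : continuous theta by move=> t; exact: is_derive1_continuous (dtheta t).
have cdot : continuous (fun t => dotp c (g t) (theta t)).
  move=> t; under eq_fun do rewrite gE.
  exact: is_derive1_continuous (is_derive_dotp c (dx t) (dy t) (dtheta t)).
have cdelta : continuous delta.
  move=> t; apply: cvgB; apply: cvgB.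
  - by apply: continuous_comp; [exact: ctheta|exact: ch].
  - exact: cdot.
  - apply: (@continuous_comp _ _ _ (fun s => theta s + pi) h); last exact: ch.
    by apply: cvgD; [exact: ctheta|exact: cvg_cst].
  - by under eq_fun do rewrite dotp_pi; rewrite dotp_pi; apply: cvgN; exact: cdot.
have no_switch s t : delta s < 0 -> ~ 0 < delta t.
  move=> s0 t0.
  have delta_ne0 u : delta u <> 0.
    by case: (normal_angle_or_opposite (xE u) (yE u)) => [/plus_lt0|/minus_gt0]; lra.
  have [st|/ltW ts] := leP s t.
    have [||u _ /delta_ne0//] := @IVT R delta s t 0 st.
      exact: continuous_subspaceT.
    by rewrite ge_min le_max !(ltW s0, ltW t0) orbT.
  have [||u _ /delta_ne0//] := @IVT R delta t s 0 ts.
    exact: continuous_subspaceT.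
  by rewrite ge_min le_max !(ltW s0, ltW t0) orbT.
have [plus|/existsNP[s Nplus]] :=
    pselect (forall t, dotp c (g t) (theta t) = h (theta t)).
  exists 1, theta, kappa; split=> //; first by left.
  - by move=> t; rewrite mulN1r.
  - by move=> t; rewrite mul1r.
have minus t : dotp c (g t) (theta t + pi) = h (theta t + pi).
  case: (normal_angle_or_opposite (xE t) (yE t)) => // /plus_lt0 t0.
  case: (normal_angle_or_opposite (xE s) (yE s)) => // /minus_gt0 s0.
  by case: (no_switch t s).
exists (- 1), (fun t => theta t + pi), kappa; split=> //; first by right.
- by move=> t; have := is_derive1D (dtheta t) (is_derive_cst pi t 1); rewrite addr0.
- by move=> t; rewrite sinDpi xE; ring.
- by move=> t; rewrite cosDpi yE; ring.
Qed.

(** The fixed point [g s] lies on the support line at [g t], so the inner product of [g s - g u]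
    with the normal at [u] has its maximum 0 at [u = t]. Its derivative there is [kappa t] times the
    tangential component of [g s - g t], which is nonzero because the normal component vanishes. *)
Lemma angle_stationary (eps : R) (Psi kappa : R -> R) (t s : R) :
  outer_normal_angle eps Psi kappa -> cos (Psi s) = cos (Psi t) -> sin (Psi s) = sin (Psi t) ->
  g s <> g t -> kappa t = 0.
Proof.
move=> [_ dPsi xE yE hPsi] cE sE gst.
set X := x s; set Y := y s.
have dotE : dotp c (X, Y) (Psi t) = h (Psi t).
  by rewrite -(support_function_direction hK cE sE) -hPsi gE /dotp cE sE.
pose f u := dotp c (X, Y) (Psi u) - dotp c (x u, y u) (Psi u).
have df (u : R) := is_derive1B
  (is_derive_dotp c (is_derive_cst X u 1) (is_derive_cst Y u 1) (dPsi u))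
  (is_derive_dotp c (dx u) (dy u) (dPsi u)).
have ft : is_derive t 1 f 0.
  apply: (@derive1_at_max R _ (t - 1) (t + 1)).
  - lra.
  - by move=> u _; case: (df u).
  - by rewrite in_itv/=; apply/andP; split; lra.
  - move=> u _; rewrite /f dotE -!gE !hPsi subrr subr_le0.
    exact: (hK _).2.
have := is_derive1_unique ft (df t); rewrite xE yE.
set C := cos (Psi t) in dotE *; set S := sin (Psi t) in dotE *.
have e1 : (X - x t) * C + (Y - y t) * S = 0.
  transitivity (dotp c (X, Y) (Psi t) - dotp c (x t, y t) (Psi t)).
    by rewrite /dotp -/C -/S /=; ring.
  by rewrite dotE -gE hPsi subrr.
have CS : C ^+ 2 + S ^+ 2 = 1 by exact: cos2Dsin2.
rewrite /cst /= => e2.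
have : kappa t * (- (X - x t) * S + (Y - y t) * C) = 0 by rewrite e2; ring.
move/eqP; rewrite mulf_eq0 => /orP[/eqP//|/eqP e3]; exfalso; apply: gst.
have Xt : X - x t = 0.
  transitivity ((X - x t) * (C ^+ 2 + S ^+ 2)); first by rewrite CS mulr1.
  transitivity (C * ((X - x t) * C + (Y - y t) * S) - S * (- (X - x t) * S + (Y - y t) * C)).
    by ring.
  by rewrite e1 e3; ring.
have Yt : Y - y t = 0.
  transitivity ((Y - y t) * (C ^+ 2 + S ^+ 2)); first by rewrite CS mulr1.
  transitivity (S * ((X - x t) * C + (Y - y t) * S) + C * (- (X - x t) * S + (Y - y t) * C)).
    by ring.
  by rewrite e1 e3; ring.
rewrite !gE; congr (_, _); apply/eqP; rewrite -subr_eq0; exact/eqP.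
Qed.

(* A second turn would meet each support line of the first one at another point;
   such a support line carries a segment of [K], so the normal angle would be
   stationary all along the first turn. *)
Lemma turning_lt (eps : R) (Psi kappa : R -> R) :
  outer_normal_angle eps Psi kappa -> eps * (Psi T - Psi 0) < 4 * pi.
Proof.
move=> nK; have [epsE dPsi _ _ _] := nK; have pi0 := @pi_gt0 R.
rewrite ltNge; apply/negP => turns.
(* While [F t < m] a full turn remains: by the intermediate value theorem the normal of [g t] recurs
   at a later [s], with [F s = F t + 2 * pi]. *)
pose F t := eps * Psi t; pose m := F T - 2 * pi.
have dF (t : R) : is_derive t 1 F (eps * kappa t).
  by have := is_derive1M (is_derive_cst eps t 1) (dPsi t); rewrite mul0r add0r.
have cF : continuous F by move=> t; exact: is_derive1_continuous (dF t).
have F0m : F 0 + 2 * pi <= m by rewrite /m /F; lra.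
have stationary t : 0 < t < T -> F t < m -> kappa t = 0.
  move=> /andP[t0 tT] Ftm.
  have [||s] := @IVT R F t T (F t + 2 * pi) (ltW tT).
  - exact: continuous_subspaceT.
  - rewrite ge_min le_max; move: Ftm; rewrite /m => Ftm.
    by apply/andP; split; apply/orP; [left|right]; lra.
  rewrite in_itv/= => /andP[ts sT] Fs.
  have [cE sE] : cos (Psi s) = cos (Psi t) /\ sin (Psi s) = sin (Psi t).
    have [e1|eN1] := epsE.
      have -> : Psi s = Psi t + pi *+ 2.
        by move: Fs; rewrite /F e1 -mulr_natl; lra.
      by rewrite cosD2pi sinD2pi.
    have -> : Psi t = Psi s + pi *+ 2.
      by move: Fs; rewrite /F eN1 -mulr_natl; lra.
    by rewrite cosD2pi sinD2pi.
  apply: angle_stationary nK cE sE _ => gst.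
  have inj : {in `[0, T[ &, injective g} by case: gK.
  have [sT'|] := ltP s T.
    have st : s = t.
      by apply: inj gst; rewrite in_itv/= ?(ltW t0)// (le_trans (ltW t0)).
    by move: Fs; rewrite st; lra.
  (* Injectivity covers only [[0, T)]; at the end point, [g T = g 0] would force [t = 0]. *)
  move=> Ts; have sE' : s = T by apply/eqP; rewrite eq_le sT.
  have g0 : g 0 = g t by rewrite -gst sE' -(gper 0) add0r.
  have : 0 = t by apply: inj g0; rewrite in_itv/= ?lexx ?T_gt0 ?(ltW t0).
  lra.
(* [mu] is twice the negative part of [s - m], with a minus sign: it vanishes from [m] on, where
   nothing is known about [kappa]. So [Phi] composed with [F] is constant on [[0, T]], although
   [Phi (F T) <= Phi m < Phi (F 0)]. *)
pose mu s : R := (s - m) - `|s - m|.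
have cmu : continuous mu.
  have cB : continuous (fun s : R => s - m).
    by move=> s; apply: cvgB; [exact: cvg_id|exact: cvg_cst].
  by move=> s; apply: cvgB; [exact: cB|apply: cvg_norm; exact: cB].
have [Phi dPhi] := antiderivative cmu.
have muge s : m <= s -> mu s = 0 by move=> ms; rewrite /mu ger0_norm ?subrr// subr_ge0.
have mult s : s < m -> mu s = 2 * (s - m).
  by move=> ms; rewrite /mu ltr0_norm ?subr_lt0//; ring.
have mule0 s : mu s <= 0.
  by have [/muge ->//|sm] := leP m s; rewrite mult//; lra.
have PhiF (t : R) : is_derive t 1 (fun t => Phi (F t)) (mu (F t) * (eps * kappa t)).
  exact: is_derive1_compl.
have PhiT : Phi (F T) = Phi (F 0).
  have [||s _] := @MVT_segment R (fun t => Phi (F t)) (fun=> 0) 0 T (ltW T_gt0).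
  - move=> t; rewrite in_itv/= => tT.
    rewrite -[X in is_derive _ _ _ X](_ : mu (F t) * (eps * kappa t) = 0)//.
    have [mF|Fm] := leP m (F t); first by rewrite muge// mul0r.
    by rewrite stationary// !mulr0.
  - by apply: continuous_subspaceT => t; exact: is_derive1_continuous (PhiF t).
  - by rewrite mul0r => /eqP; rewrite subr_eq0 => /eqP.
have PhiTm : Phi (F T) <= Phi m.
  apply: (is_derive_le0_nincr dPhi mule0); rewrite /m; lra.
have F0ltm : F 0 < m by lra.
have [|s] := MVT F0ltm (fun t _ => dPhi t).
  by apply: continuous_subspaceT => t; exact: is_derive1_continuous (dPhi t).
rewrite in_itv/= => /andP[_ sm]; rewrite mult// => H.
have : 2 * (s - m) * (m - F 0) < 0 by rewrite nmulr_rlt0; lra.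
lra.
Qed.

Lemma arc_length_le (beta m : R) :
  (forall phi, h phi + h (phi + beta) <= m) -> arc_length g 0 T <= pi * m.
Proof.
move=> hm; have [eps [Psi [kappa nK]]] := outer_normal_angle_exists.
have [epsE dPsi xE yE hPsi] := nK; have turning := turning_lt nK.
have hper phi : h (phi + 2 * pi) = h phi.
  rewrite mulr_natl.
  exact: support_function_direction hK (cosD2pi phi) (sinD2pi phi).
have [Q dQ] := antiderivative (support_function_continuous compactK hK).
have [W [W0 Wm QW]] := periodic_primitive dQ hper hm (fun phi => ltW (width_gt0 phi)).
have cspeed : continuous (speed g).
  have cd (f : R -> R) (df : R -> R) : (forall t : R, is_derive t 1 f (df t)) ->
      continuous (fun t => f t ^+ 2).
    move=> fdf; under eq_fun do rewrite expr2.
    by move=> t; apply: cvgM; exact: is_derive1_continuous (fdf t).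
  move=> t; apply: continuous_comp; last exact: sqrt_continuous.
  by apply: cvgD; [exact: (cd _ _ ddx)|exact: (cd _ _ ddy)].
have [S dS] := antiderivative cspeed.
have -> : arc_length g 0 T = S T - S 0 by exact: Rintegral_FTC2 T_gt0 cspeed dS.
have dPsi' (t : R) : is_derive t 1 (fun s => Psi s + pi / 2) (kappa t).
  by have := is_derive1D (dPsi t) (is_derive_cst (pi / 2) t 1); rewrite addr0.
(* The inner product of [g - c] with [eps] times the unit tangent. *)
pose tangential t := dotp c (x t, y t) (Psi t + pi / 2).
have dQPsi (t : R) : is_derive t 1 (fun s => Q (Psi s)) (h (Psi t) * kappa t).
  exact: is_derive1_compl.
(* This is the integration by parts: differentiating [tangential] gives
   [eps * speed g t - h (Psi t) * kappa t], and the last term cancels against the derivative of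
   [Q (Psi t)]. *)
pose E t := S t - eps * (tangential t + Q (Psi t)).
have eps2 : eps * eps = 1 by case: epsE => ->; ring.
have dE (t : R) : is_derive t 1 E 0.
  have := is_derive1B (dS t) (is_derive1M (is_derive_cst eps t 1)
    (is_derive1D (is_derive_dotp c (dx t) (dy t) (dPsi' t)) (dQPsi t))).
  congr (is_derive _ _ _ _).
  rewrite mul0r add0r /cst cosDpihalf sinDpihalf xE yE -hPsi gE /dotp /=.
  transitivity (speed g t * (1 - (eps * eps) * (cos (Psi t) ^+ 2 + sin (Psi t) ^+ 2))).
    by ring.
  by rewrite eps2 cos2Dsin2; ring.
have ET : E T = E 0 by exact: is_derive_0_is_cst.
have xT : x T = x 0 by rewrite /x /= -(gper 0) add0r.
have yT : y T = y 0 by rewrite /y /= -(gper 0) add0r.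
have dxT : derive1 x T = derive1 x 0.
  rewrite -[in LHS](add0r T); apply: (derive1_periodic 0 dx) => s.
  by rewrite /x /= gper.
have dyT : derive1 y T = derive1 y 0.
  rewrite -[in LHS](add0r T); apply: (derive1_periodic 0 dy) => s.
  by rewrite /y /= gper.
have sT : speed g T = speed g 0 by rewrite /speed -/x -/y dxT dyT.
have eps_speed : eps * speed g 0 != 0.
  rewrite mulf_neq0//; last by rewrite gt_eqF// sqrtr_gt0; exact: speed_gt0.
  by case: epsE => ->; rewrite ?oppr_eq0 oner_eq0.
have cT : cos (Psi 0) = cos (Psi T).
  by apply: (mulfI eps_speed); rewrite -yE -sT -yE dyT.
have snT : sin (Psi 0) = sin (Psi T).
  by apply: (mulfI eps_speed); apply: oppr_inj; rewrite -!mulNr -xE -sT -xE dxT.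
have tanT : tangential T = tangential 0.
  by rewrite /tangential xT yT /dotp !cosDpihalf !sinDpihalf cT snT.
have -> : S T - S 0 = eps * (Q (Psi T) - Q (Psi 0)).
  by move: ET; rewrite /E tanT; lra.
have [k kE] := same_direction_turns cT snT.
rewrite kE (periodic_primitive_turns _ _ QW) (_ : Q _ + _ - _ = k%:~R * W); last by ring.
apply: le_trans Wm.
move: turning; rewrite kE (_ : Psi 0 + _ - _ = k%:~R * (2 * pi)); last by ring.
have pi0 := @pi_gt0 R; rewrite !mulrA => turning.
(* The length is now [eps * k * W]. The turning bound gives [eps * k < 2]; as an integer it is at
   most 1, and [0 <= W] concludes. *)
have k2 : eps * k%:~R < 2 :> R.
  have : (eps * k%:~R - 2) * (2 * pi) < 0 by lra.
  by rewrite pmulr_llt0 ?subr_lt0//; lra.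
have int_lt2 (j : int) : j%:~R < 2 :> R -> j%:~R <= 1 :> R.
  by rewrite (ltr_int R j 2) (ler_int R j 1); lia.
have k1 : eps * k%:~R <= 1 :> R.
  by case: epsE k2 => ->; rewrite ?mul1r ?mulN1r -?mulrNz; exact: int_lt2.
by rewrite -[X in _ <= X]mul1r ler_wpM2r.
Qed.

End ConvexCurve.

Theorem theorem5p3 (R : realType) (K : set (plane R)) (L alpha r : R)
  (compactK : compact K) (convexK : convex_set K)
  (C2K : C2_frontier K) (perimeterK : has_perimeter K L)
  (alpha_pi : 0 < alpha < pi) (r_gt0 : 0 < r)
  (circleK : exists c : plane R, isotopic_set K alpha = circle c r) :
  L <= 2 * pi * r * sin (alpha / 2).
Proof.
have [g [T [gK ->]]] := perimeterK; have [c isoE] := circleK.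
have K0 : K !=set0.
  have : frontier K (g 0) by case: gK => _ _ _ _ <-; exists 0.
  move=> [clK _]; exists (g 0); move: clK; rewrite -(proj1 (closure_id K))//.
  exact: compact_closed compactK.
have [h hK] := support_function_exists c compactK K0.
have sum_le phi : h phi + h (phi + (pi - alpha)) <= 2 * r * sin (alpha / 2).
  apply: (support_sum_le _ hK alpha_pi r_gt0 _ isoE) => P s t.
  exact: unique_normal compactK hK gK P s t.
have := arc_length_le compactK convexK hK gK sum_le.
by rewrite (_ : pi * _ = 2 * pi * r * sin (alpha / 2)); last by ring.
Qed.
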